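(* Let $D,\lambda>0$ with $D/\lambda\ge 1/2$. For $\theta\in[0,\pi]$ let $d^{\mathrm N}(\theta)\ge 0$ be the Fresnel distance function of the phased array of largest dimension $D$ at wavelength $\lambda$, i.e. the solution of $$\frac{D^3}{\lambda}|\cos\theta|\sin^2(\theta)\left(1+\min\left\{1,\frac{2d^{\mathrm N}|\cos\theta|}{D}\right\}\right)^3=(d^{\mathrm N})^2.$$ Then the Fresnel distance $\overline d^{\mathrm N}=\max_{\theta\in[0,\pi]}d^{\mathrm N}(\theta)$ of the phased array is $$\overline d^{\mathrm N}=\frac{4}{3^{3/4}}\sqrt{\frac{D^3}{\lambda}}=\sqrt8\,\cdot\,\overline d^{\mathrm{N0}},$$ where $\overline d^{\mathrm{N0}}=\max_{\theta\in[0,\pi]}\sqrt{|\cos\theta|\sin^2\theta\,D^3/\lambda}=\sqrt{\tfrac{2}{3\sqrt3}}\,\sqrt{D^3/\lambda}$ is the Fresnel distance of a single-element antenna having the same diameter $D$.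
   Context: Here $D$ is the largest dimension of a phased array antenna (uniform linear array), $\lambda$ is the wavelength, and $\theta$ is the observation angle between the antenna plane and the line joining the antenna center to the source. The third-order phase term at separation $d'$ and distance $r$ has magnitude $|\Delta\theta_3|=\frac{\pi}{\lambda}|\cos\theta|\sin^2(\theta)(d')^3r^{-2}$. The Fresnel distance function of the phased array is the value of $r$ for which this equals $\pi/8$ when $d'=D/2+\min\{|r\cos\theta|,D/2\}$; this is the equation displayed in the claim, which is used as the definition of $d^{\mathrm N}(\theta)$. For a center-fed single-element antenna of diameter $D$ the Fresnel distance function is obtained with $d'=D/2$ instead, giving $d^{\mathrm{N0}}(\theta)=\sqrt{|\cos\theta|\sin^2\theta\,D^3/\lambda}$. In both cases, the ''Fresnel distance'' means the maximum over $\theta$ of the Fresnel distance function. *)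

(* Defs.v *)
From Stdlib Require Import Reals ClassicalEpsilon.
Open Scope R_scope.

(* [r] is a nonnegative solution of the equation saying that the third-order
   phase term (PI / lambda) |cos theta| sin^2 theta d'^3 / r^2 equals PI / 8 for
   d' = D / 2 + min (|r cos theta|, D / 2), with denominators in r cleared; thus
   r = 0 is a solution whenever cos theta * sin theta = 0. *)
Definition array_fresnel_eq (D lambda theta r : R) : Prop :=
  0 <= r /\
  D ^ 3 / lambda * Rabs (cos theta) * sin theta ^ 2
    * (1 + Rmin 1 (2 * r * Rabs (cos theta) / D)) ^ 3 = r ^ 2.

(* The chosen value is meaningful only when [array_fresnel_eq D lambda theta]
   has a unique solution. *)
Definition array_fresnel (D lambda theta : R) : R :=
  epsilon (inhabits 0) (array_fresnel_eq D lambda theta).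

Definition single_fresnel (D lambda theta : R) : R :=
  sqrt (Rabs (cos theta) * sin theta ^ 2 * D ^ 3 / lambda).

Definition is_max_on (f : R -> R) (a b m : R) : Prop :=
  (exists x, a <= x <= b /\ f x = m) /\ (forall x, a <= x <= b -> f x <= m).

(* The Fresnel distance attached to a Fresnel distance function [d]. *)
Definition is_fresnel_distance (d : R -> R) (m : R) : Prop :=
  is_max_on d 0 PI m.

(* Main.v *)
Require Import Defs.
From Stdlib Require Import Reals Lra Psatz ClassicalEpsilon.
Open Scope R_scope.

(** With [A = D^3/lambda |cos theta| sin^2 theta] and [k = 2 |cos theta| / D]
    the equation reads [r^2 = A (1 + min(1, k r))^3].  Its solution is unique
    because [(1 + min(1, k r))^3 / r^2] is strictly decreasing in [r].  The
    factor in parentheses is at most 2, so [r <= sqrt (8 A)], with equality as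
    soon as [k sqrt (8 A) >= 1].  Finally [|cos theta| sin^2 theta] is largest
    at [cos theta = 1 / sqrt 3], and there [D / lambda >= 1/2] gives
    [k sqrt (8 A) >= 1]. *)

(** The ratio is cross-multiplied so that [r = 0] is allowed. The cases follow the position of [r]
    and [s] relative to [1 / k], where the cap sets in: below it the difference of the two sides
    factors through [s - r], and above it both cubes equal 8. *)
Lemma capped_cube_ratio_decreasing (k r s : R) :
  0 <= k -> 0 <= r -> r < s ->
  r ^ 2 * (1 + Rmin 1 (k * s)) ^ 3 < s ^ 2 * (1 + Rmin 1 (k * r)) ^ 3.
Proof.
intros hk hr hrs.
assert (hkr : 0 <= k * r) by nra.
assert (hle : k * r <= k * s) by nra.
destruct (Rle_lt_dec (k * s) 1) as [hs | hs].
- rewrite !Rmin_right by lra.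
  assert (hf : s ^ 2 * (1 + k * r) ^ 3 - r ^ 2 * (1 + k * s) ^ 3
     = (s - r) * (s + r + 2 * (k * r * s)
                  + k * r * s * (1 - (k * r) * (k * s)))) by ring.
  assert (0 <= k * r * s) by nra.
  assert (0 <= 1 - (k * r) * (k * s)) by nra.
  assert (0 <= k * r * s * (1 - (k * r) * (k * s))) by nra.
  nra.
- rewrite (Rmin_left 1 (k * s)) by lra.
  destruct (Rle_lt_dec (k * r) 1) as [h1 | h1].
  + rewrite Rmin_right by lra.
    (* Here [k * r <= 1 < k * s]: after multiplication by [k ^ 2], this compares [r] with the
       threshold [1 / k], and [1 < (k * s) ^ 2] compares the threshold with [s]. *)
    assert (hx : 8 * (k * r) ^ 2 <= (1 + k * r) ^ 3).
    { assert (hf : (1 + k * r) ^ 3 - 8 * (k * r) ^ 2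
        = (1 - k * r) * (1 + 4 * (k * r) - (k * r) ^ 2)) by ring.
      assert (0 <= 1 + 4 * (k * r) - (k * r) ^ 2) by nra.
      nra. }
    assert (hc : 0 < (1 + k * r) ^ 3) by (apply pow_lt; lra).
    assert (hs2 : 1 < (k * s) ^ 2) by nra.
    assert (hk0 : 0 < k) by (destruct hk as [? | <-]; lra).
    assert (hk2 : 0 < k ^ 2) by (apply pow_lt; lra).
    apply (Rmult_lt_reg_l (k ^ 2)); [exact hk2 |].
    nra.
  + rewrite Rmin_left by lra.
    nra.
Qed.

Lemma capped_cube_solution_unique (A k r s : R) :
  0 <= k -> 0 <= r -> 0 <= s ->
  A * (1 + Rmin 1 (k * r)) ^ 3 = r ^ 2 ->
  A * (1 + Rmin 1 (k * s)) ^ 3 = s ^ 2 -> r = s.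
Proof.
intros hk hr hs er es.
destruct (Rtotal_order r s) as [h | [h | h]]; [| exact h |].
- pose proof (capped_cube_ratio_decreasing k r s hk hr h) as hlt.
  rewrite <- er, <- es in hlt; lra.
- pose proof (capped_cube_ratio_decreasing k s r hk hs h) as hlt.
  rewrite <- er, <- es in hlt; lra.
Qed.

Lemma capped_cube_solution_saturated (A k r : R) :
  1 <= k * r -> r ^ 2 = 8 * A ->
  A * (1 + Rmin 1 (k * r)) ^ 3 = r ^ 2.
Proof.
intros h e; rewrite Rmin_left by lra; lra.
Qed.

(** Either the saturated candidate [sqrt (8 * A)] reaches the cap and is a solution, or the
    intermediate value theorem gives a root of the uncapped equation below it, where the cap is
    inactive. *)
Lemma capped_cube_solution_exists (A k : R) :
  0 <= A -> 0 <= k ->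
  exists r, 0 <= r /\ A * (1 + Rmin 1 (k * r)) ^ 3 = r ^ 2.
Proof.
intros hA hk.
assert (hb := sqrt_pos (8 * A)).
assert (eb : sqrt (8 * A) ^ 2 = 8 * A) by (apply pow2_sqrt; lra).
set (b := sqrt (8 * A)) in *.
destruct (Rle_lt_dec 1 (k * b)) as [h | h].
- exists b; split; [exact hb | now apply capped_cube_solution_saturated].
- assert (hkb : 0 <= k * b) by nra.
  destruct (IVT_cor (fun r => r ^ 2 - A * (1 + k * r) ^ 3) 0 b)
    as [r [[hr0 hrb] er]].
  + reg.
  + exact hb.
  (* The function is [- A] at 0 and at least [8 * A - 8 * A] at [b], so its values there have
     opposite signs or vanish. *)
  + assert ((1 + k * b) ^ 3 <= 2 ^ 3) by (apply pow_incr; lra).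
    cbv beta; rewrite eb; nra.
  + exists r; split; [exact hr0 |].
    rewrite Rmin_right by nra.
    lra.
Qed.

Lemma capped_cube_solution_bound (A k r : R) :
  0 <= A -> 0 <= k -> 0 <= r ->
  A * (1 + Rmin 1 (k * r)) ^ 3 = r ^ 2 -> r ^ 2 <= 8 * A.
Proof.
intros hA hk hr <-.
assert (0 <= k * r) by nra.
assert (0 <= Rmin 1 (k * r)) by (apply Rmin_glb; lra).
assert (h1 := Rmin_l 1 (k * r)).
assert ((1 + Rmin 1 (k * r)) ^ 3 <= 2 ^ 3) by (apply pow_incr; lra).
nra.
Qed.

Lemma inv_sqrt3_sqr : (/ sqrt 3) ^ 2 = / 3.
Proof. rewrite pow_inv, pow2_sqrt; lra. Qed.

Lemma inv_sqrt3_bounds : 0 < / sqrt 3 < 1.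
Proof.
assert (0 < / sqrt 3) by (apply Rinv_0_lt_compat, sqrt_lt_R0; lra).
pose proof inv_sqrt3_sqr; nra.
Qed.

Lemma Rabs_cos_sin_sqr_bound (theta : R) :
  Rabs (cos theta) * sin theta ^ 2 <= 2 / (3 * sqrt 3).
Proof.
replace (2 / (3 * sqrt 3)) with (2 / 3 * / sqrt 3)
  by (field; apply Rgt_not_eq, sqrt_lt_R0; lra).
pose proof inv_sqrt3_sqr as ht2; pose proof inv_sqrt3_bounds as ht.
set (t := / sqrt 3) in *.
assert (hc := Rabs_pos (cos theta)).
assert (es : sin theta ^ 2 = 1 - Rabs (cos theta) ^ 2).
{ rewrite pow2_abs; pose proof (sin2_cos2 theta); unfold Rsqr in *; lra. }
rewrite es; set (c := Rabs (cos theta)) in *.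
(* [2 t^3 - (3 t^2 c - c^3) = (c - t)^2 (c + 2 t)] and [3 t^2 = 1] *)
assert (0 <= (c - t) ^ 2 * (c + 2 * t)).
{ apply Rmult_le_pos; [apply pow2_ge_0 | lra]. }
assert (hid : (c - t) ^ 2 * (c + 2 * t) = c ^ 3 - 3 * t ^ 2 * c + 2 * t * t ^ 2)
  by ring.
rewrite ht2 in hid; lra.
Qed.

Lemma Rabs_cos_sin_sqr_acos :
  Rabs (cos (acos (/ sqrt 3))) * sin (acos (/ sqrt 3)) ^ 2 = 2 / (3 * sqrt 3).
Proof.
pose proof inv_sqrt3_sqr as ht2; pose proof inv_sqrt3_bounds as ht.
pose proof (sin2_cos2 (acos (/ sqrt 3))) as h; unfold Rsqr in h.
rewrite cos_acos in * by lra.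
rewrite Rabs_right by lra.
replace (sin (acos (/ sqrt 3)) ^ 2) with (2 / 3) by lra.
field; apply Rgt_not_eq, sqrt_lt_R0; lra.
Qed.

(** Both sides are nonnegative with square [16 / (3 * sqrt 3)], since the square of 3^(3/4) is 3^(1
    + 1/2). *)
Lemma sqrt8_fresnel_constant :
  sqrt 8 * sqrt (2 / (3 * sqrt 3)) = 4 / Rpower 3 (3 / 4).
Proof.
assert (h3 : 0 < sqrt 3) by (apply sqrt_lt_R0; lra).
assert (hp : 0 < Rpower 3 (3 / 4)) by apply exp_pos.
assert (hp2 : Rpower 3 (3 / 4) ^ 2 = 3 * sqrt 3).
{ rewrite <- (Rpower_pow 2) by exact hp.
  replace (3 * sqrt 3) with (Rpower 3 1 * Rpower 3 (/ 2))
    by (rewrite Rpower_1, Rpower_sqrt; lra).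
  rewrite Rpower_mult, <- Rpower_plus; f_equal; simpl; lra. }
rewrite <- sqrt_mult_alt by lra.
apply sqrt_lem_1.
- apply Rlt_le, Rmult_lt_0_compat; [lra | apply Rdiv_lt_0_compat; lra].
- apply Rlt_le, Rdiv_lt_0_compat; lra.
- rewrite <- hp2; field; lra.
Qed.

Lemma array_fresnel_eq_capped_cube (D lambda theta r : R) :
  array_fresnel_eq D lambda theta r <->
  0 <= r /\
  D ^ 3 / lambda * (Rabs (cos theta) * sin theta ^ 2)
    * (1 + Rmin 1 (2 * Rabs (cos theta) / D * r)) ^ 3 = r ^ 2.
Proof.
unfold array_fresnel_eq.
replace (2 * r * Rabs (cos theta) / D) with (2 * Rabs (cos theta) / D * r)
  by (unfold Rdiv; ring).
now rewrite Rmult_assoc with (r1 := D ^ 3 / lambda).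
Qed.

Theorem lemma2 (D lambda : R) (hD : 0 < D) (hlambda : 0 < lambda)
    (hDlambda : 1 / 2 <= D / lambda) :
  (forall theta : R, 0 <= theta <= PI ->
     exists! r : R, array_fresnel_eq D lambda theta r) /\
  (exists dN dN0 : R,
     is_fresnel_distance (array_fresnel D lambda) dN /\
     is_fresnel_distance (single_fresnel D lambda) dN0 /\
     dN = 4 / Rpower 3 (3 / 4) * sqrt (D ^ 3 / lambda) /\
     dN = sqrt 8 * dN0 /\
     dN0 = sqrt (2 / (3 * sqrt 3)) * sqrt (D ^ 3 / lambda)).
Proof.
assert (hE : 0 < D ^ 3 / lambda)
  by (apply Rdiv_lt_0_compat; [apply pow_lt |]; assumption).
assert (hk : forall theta, 0 <= 2 * Rabs (cos theta) / D).
{ intros theta; pose proof (Rabs_pos (cos theta)).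
  apply Rmult_le_pos; [lra | now apply Rlt_le, Rinv_0_lt_compat]. }
assert (hw : forall theta, 0 <= Rabs (cos theta) * sin theta ^ 2).
{ intros theta; apply Rmult_le_pos; [apply Rabs_pos | apply pow2_ge_0]. }
assert (hA : forall theta,
  0 <= D ^ 3 / lambda * (Rabs (cos theta) * sin theta ^ 2)).
{ intros theta; apply Rmult_le_pos; [lra | apply hw]. }
assert (hex : forall theta, exists r, array_fresnel_eq D lambda theta r).
{ intros theta.
  destruct (capped_cube_solution_exists _ _ (hA theta) (hk theta)) as [r hr].
  exists r; now apply array_fresnel_eq_capped_cube. }
assert (huniq : forall theta r s, array_fresnel_eq D lambda theta r ->
  array_fresnel_eq D lambda theta s -> r = s).
{ intros theta r s [hr er]%array_fresnel_eq_capped_cube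
    [hs es]%array_fresnel_eq_capped_cube.
  exact (capped_cube_solution_unique _ _ _ _ (hk theta) hr hs er es). }
assert (hspec : forall theta,
  array_fresnel_eq D lambda theta (array_fresnel D lambda theta)).
{ intros theta; exact (epsilon_spec _ _ (hex theta)). }
assert (h3 : 0 < sqrt 3) by (apply sqrt_lt_R0; lra).
assert (hM : 0 < 2 / (3 * sqrt 3)) by (apply Rdiv_lt_0_compat; lra).
pose proof inv_sqrt3_bounds as ht; pose proof inv_sqrt3_sqr as ht2.
split.
{ intros theta _.
  destruct (hex theta) as [r hr].
  exists r; split; [exact hr | intros s hs; now apply (huniq theta)]. }
set (dN0 := sqrt (2 / (3 * sqrt 3)) * sqrt (D ^ 3 / lambda)).
assert (hdN0 : dN0 = sqrt (2 / (3 * sqrt 3) * (D ^ 3 / lambda))).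
{ unfold dN0; rewrite sqrt_mult; lra. }
(* This is the saturated value [8 * A] at the angle [acos (/ sqrt 3)]. *)
assert (hdN : (sqrt 8 * dN0) ^ 2
  = 8 * (D ^ 3 / lambda * (2 / (3 * sqrt 3)))).
{ rewrite hdN0, Rpow_mult_distr, !pow2_sqrt; [ring | | lra].
  apply Rmult_le_pos; lra. }
assert (hdNpos : 0 <= sqrt 8 * dN0).
{ rewrite hdN0; apply Rmult_le_pos; apply sqrt_pos. }
exists (sqrt 8 * dN0), dN0.
split; [| split; [| split; [| split]]].
- split.
  + exists (acos (/ sqrt 3)); split; [apply acos_bound |].
    (* The value picked by [epsilon] is identified through uniqueness: it suffices that
       [sqrt 8 * dN0] solves the equation at this angle. *)
    apply (huniq (acos (/ sqrt 3))); [apply hspec |].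
    apply array_fresnel_eq_capped_cube; split; [exact hdNpos |].
    rewrite Rabs_cos_sin_sqr_acos.
    apply capped_cube_solution_saturated; [| exact hdN].
    rewrite cos_acos, Rabs_right by lra.
    apply Rsqr_incr_0_var;
      [| apply Rmult_le_pos; [| exact hdNpos];
         apply Rlt_le, Rdiv_lt_0_compat; lra].
    rewrite !Rsqr_pow2, (Rpow_mult_distr _ (sqrt 8 * dN0)), hdN.
    replace ((2 * / sqrt 3 / D) ^ 2 * (8 * (D ^ 3 / lambda * (2 / (3 * sqrt 3)))))
      with (64 / 3 * ((/ sqrt 3) ^ 2 * / sqrt 3) * (D / lambda))
      by (field; lra).
    rewrite ht2.
    (* A rational lower bound, as 81/256 < 1/3. With [D / lambda] at least 1/2, the square of
       [k * r] is at least 64/9 * 9/16 * 1/2 = 2, so the cap is reached. *)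
    assert (9 / 16 <= / sqrt 3) by nra.
    nra.
  + intros theta _.
    destruct (proj1 (array_fresnel_eq_capped_cube _ _ _ _) (hspec theta))
      as [hr er].
    (* The bound by [8 * A] holds at every angle, whether or not the cap is reached there, so no
       case split is needed. *)
    apply Rsqr_incr_0_var; [| exact hdNpos].
    rewrite !Rsqr_pow2, hdN.
    apply (Rle_trans _ _ _
      (capped_cube_solution_bound _ _ _ (hA theta) (hk theta) hr er)).
    apply Rmult_le_compat_l; [lra |].
    apply Rmult_le_compat_l; [lra | apply Rabs_cos_sin_sqr_bound].
- assert (hsingle : forall theta, single_fresnel D lambda theta
    = sqrt (Rabs (cos theta) * sin theta ^ 2 * (D ^ 3 / lambda))).
  { intros theta; unfold single_fresnel; f_equal; unfold Rdiv; ring. }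
  rewrite hdN0; split.
  + exists (acos (/ sqrt 3)); split; [apply acos_bound |].
    now rewrite hsingle, Rabs_cos_sin_sqr_acos.
  + intros theta _; rewrite hsingle.
    apply sqrt_le_1_alt, Rmult_le_compat_r;
      [lra | apply Rabs_cos_sin_sqr_bound].
- unfold dN0; rewrite <- Rmult_assoc; f_equal.
  apply sqrt8_fresnel_constant.
- reflexivity.
- reflexivity.
Qed.
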